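(* Let $J$ be a finite ground set and let $\mathscr{S}=\{I\subseteq J:|I|=\ell\}$ (the cardinality constraint of degree $\ell$). Then $\operatorname{CDC}(\mathscr{S})$ is $k$-way IB-representable if and only if $k>\ell$.
   Context: $\Delta^J=\{\lambda\in\mathbb{R}^J_{\ge 0}:\sum_{v\in J}\lambda_v=1\}$. For $S\subseteq J$, $Q(S)=\{\lambda\in\Delta^J:\lambda_v\le 0\ \forall v\in J\setminus S\}$, and $\operatorname{CDC}(\mathscr{S})=\bigcup_{S\in\mathscr{S}}Q(S)$. It is a standing assumption that $\mathscr{S}$ is irredundant (no distinct $S,T\in\mathscr{S}$ with $S\subseteq T$) and covers the ground set ($\bigcup_{S\in\mathscr{S}}S=J$). A $k$-way independent branching (IB) scheme for $\operatorname{CDC}(\mathscr{S})$ is a family $(L^j_1,\ldots,L^j_k)$, $j\in\{1,\ldots,t\}$, with each $L^j_i\subseteq J$, such that $\operatorname{CDC}(\mathscr{S})=\bigcap_{j=1}^t\bigcup_{i=1}^k Q(L^j_i)$. $\operatorname{CDC}(\mathscr{S})$ is $k$-way IB-representable if it admits a $k$-way IB scheme.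
   Formalization: The formal theorem adds the assumption ℓ < |J|; for ℓ = |J| ≥ 1 the set CDC(𝒮) is the whole simplex, which has a 1-way IB scheme, so the ''only if'' direction fails there (and the empty ground set is likewise excluded). *)

(* Defs.v *)
From mathcomp Require Import all_boot all_order all_algebra.
From mathcomp Require Import all_classical all_reals.

Set Implicit Arguments.
Unset Strict Implicit.
Unset Printing Implicit Defensive.

Import Order.TTheory GRing.Theory Num.Theory.
Local Open Scope classical_set_scope.
Local Open Scope ring_scope.

Definition simplex (R : realType) (J : finType) : set {ffun J -> R} :=
  [set x : {ffun J -> R} | (forall v, 0 <= x v) /\ \sum_(v : J) x v = 1]%classic.
Arguments simplex R J : clear implicits.

Definition face (R : realType) {J : finType} (S : {set J}) :
    set {ffun J -> R} :=
  [set x : {ffun J -> R} | simplex R J x /\ forall v, v \notin S -> x v <= 0]%classic.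
Arguments face R {J} S.

Definition CDC (R : realType) {J : finType} (SS : {set {set J}}) :
    set {ffun J -> R} :=
  \bigcup_(S in [set` SS]) face R S.
Arguments CDC R {J} SS.

Definition irredundant (J : finType) (SS : {set {set J}}) : Prop :=
  forall S T : {set J}, S \in SS -> T \in SS -> S \subset T -> S = T.

Definition covers (J : finType) (SS : {set {set J}}) : Prop :=
  finset.cover SS = [set: J]%SET.

(* For t = 0 the intersection is the whole space R^J, which is never a CDC. *)
Definition IB_scheme (R : realType) (J : finType) (SS : {set {set J}})
    (k t : nat) (L : 'I_t -> 'I_k -> {set J}) : Prop :=
  CDC R SS =
    \bigcap_(j in [set: 'I_t]) \bigcup_(i in [set: 'I_k]) face R (L j i).

Definition IB_representable (R : realType) (J : finType) (SS : {set {set J}})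
    (k : nat) : Prop :=
  exists (t : nat) (L : 'I_t -> 'I_k -> {set J}), IB_scheme R SS L.

Definition cardinality_family (J : finType) (ell : nat) : {set {set J}} :=
  [set I : {set J} | #|I| == ell]%SET.

(* Main.v *)
(* The points of the CDC are the points of the simplex with at most [ell]
   nonzero coordinates.  If [ell < k], each [C] with [ell + 1] elements gives a
   disjunction "some coordinate in [C] vanishes", and their conjunction says
   exactly that.  Conversely, the barycenter of an [(ell + 1)]-set lies outside
   the CDC, so some index [j] of the scheme excludes it, and every [L j i]
   misses a point [c i].  If [k <= ell], these points fit in a set [S] of size
   [ell], whose barycenter lies in the CDC but is excluded by [j] as well. *)
Require Import Defs.
From mathcomp Require Import all_boot all_order all_algebra.
From mathcomp Require Import all_classical all_reals.

Import Order.TTheory GRing.Theory Num.Theory.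
Local Open Scope ring_scope.

Lemma subset_between_card (J : finType) (A B : {set J}) (n : nat) :
  A \subset B -> (#|A| <= n <= #|B|)%N ->
  exists S : {set J}, [/\ A \subset S, S \subset B & #|S| = n].
Proof.
move=> sAB /andP[leAn lenB].
(* With [A] listed first, every prefix of [s] of length at least [#|A|] contains [A]. *)
set s := enum A ++ enum (B :\: A)%SET.
have us : uniq s.
  rewrite cat_uniq !enum_uniq andbT /=; apply/hasPn => x.
  by rewrite !mem_enum finset.inE => /andP[].
have sz : (n <= size s)%N.
  by rewrite size_cat -!cardE cardsDS // subnKC // subset_leq_card.
exists [set x in take n s]%SET; split.
- apply/fintype.subsetP => x xA; rewrite finset.inE take_cat -cardE.
  by rewrite ltnNge leAn /= mem_cat mem_enum xA.
- apply/fintype.subsetP => x; rewrite finset.inE => /mem_take.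
  rewrite mem_cat !mem_enum => /orP[/(fintype.subsetP sAB)//|].
  by rewrite finset.inE => /andP[].
- by rewrite cardsE (card_uniqP _) ?take_uniq// size_take_min (minn_idPl sz).
Qed.

Definition barycenter (R : realType) (J : finType) (S : {set J}) :
    {ffun J -> R} := [ffun v => if v \in S then #|S|%:R^-1 else 0].

Lemma barycenter_simplex (R : realType) (J : finType) (S : {set J}) :
  (0 < #|S|)%N -> simplex R J (barycenter R J S).
Proof.
move=> S0; split=> [v|]; first by rewrite ffunE; case: ifP; rewrite ?invr_ge0.
under eq_bigr do rewrite ffunE.
by rewrite -big_mkcond sumr_const -[LHS]mulr_natl divff// pnatr_eq0 -lt0n.
Qed.

Lemma barycenter_gt0 (R : realType) (J : finType) (S : {set J}) (v : J) :
  v \in S -> 0 < barycenter R J S v.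
Proof.
by move=> vS; rewrite ffunE vS invr_gt0 ltr0n card_gt0; apply/set0Pn; exists v.
Qed.

Lemma barycenter_face (R : realType) (J : finType) (S T : {set J}) :
  (0 < #|S|)%N -> face R T (barycenter R J S) <-> S \subset T.
Proof.
move=> S0; split=> [[_ h]|/fintype.subsetP sST].
  apply/fintype.subsetP => v vS; apply/negPn/negP => /h.
  by rewrite leNgt barycenter_gt0.
split; first exact: barycenter_simplex.
by move=> v vT; rewrite ffunE ifN//; apply: contra vT; exact: sST.
Qed.

(** Since [ell <= #|J|], a support with fewer than [ell] elements can be enlarged to a member of the
    family. *)
Lemma CDC_cardinalityP (R : realType) (J : finType) (ell : nat)
    (x : {ffun J -> R}) :
  (ell <= #|J|)%N ->
  CDC R (cardinality_family J ell) x <->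
  simplex R J x /\ (#|[set v | x v != 0%R]%SET| <= ell)%N.
Proof.
move=> leJ; split=> [[S /=]|[sx lex]].
  rewrite finset.inE => /eqP <- [sx h]; split=> //.
  apply/subset_leq_card/fintype.subsetP => v; rewrite finset.inE.
  by apply: contraR => /h xv0; rewrite eq_le xv0 sx.1.
have [|S [xS _ cS]] := @subset_between_card J _ [set: J] ell
    (finset.subsetT [set v | x v != 0]%SET).
  by rewrite lex cardsT.
exists S; first by rewrite /= finset.inE cS.
split=> // v; apply: contraR; rewrite -ltNge => xv0.
by apply: (fintype.subsetP xS); rewrite finset.inE gt_eqF.
Qed.

(** Rules out [ell = 0], where the CDC is empty and even [k = 0] suffices. *)
Lemma covers_cardinality_gt0 (J : finType) (ell : nat) :
  (0 < #|J|)%N -> covers (cardinality_family J ell) -> (0 < ell)%N.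
Proof.
move=> /card_gt0P[v _] hcov.
have : v \in finset.cover (cardinality_family J ell) by rewrite hcov finset.inE.
case/bigcupP => S; rewrite finset.inE => /eqP <- vS.
by rewrite card_gt0; apply/set0Pn; exists v.
Qed.

Lemma cardinality_IB_lower (R : realType) (J : finType) (ell k : nat) :
  (0 < ell)%N -> (ell < #|J|)%N ->
  IB_representable R (cardinality_family J ell) k -> (ell < k)%N.
Proof.
move=> ell0 hell [t [L hL]]; rewrite ltnNge; apply/negP => lek.
have [|C [_ _ cC]] := @subset_between_card J _ [set: J] ell.+1
    (finset.sub0set _).
  by rewrite cards0 cardsT.
have C0 : (0 < #|C|)%N by rewrite cC.
(* Otherwise the barycenter of [C] would satisfy every disjunction, forcing [C] into a set of size
   [ell]. *)
have [j nj] : exists j, forall i, ~~ (C \subset L j i).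
  apply: contrapT => /forallNP hj.
  have : CDC R (cardinality_family J ell) (barycenter R J C).
    rewrite hL => j _; have /existsNP[i /negP/negPn sC] := hj j.
    by exists i => //; apply/barycenter_face.
  move=> [S /=]; rewrite finset.inE => /eqP cS /(barycenter_face _ _ _ _ C0).
  by move=> /subset_leq_card; rewrite cC cS ltnn.
have /choice[c hc] : forall i, exists v, v \notin L j i.
  by move=> i; have /subsetPn[v _ vL] := nj i; exists v.
have [|S [cS _ eS]] := @subset_between_card J _ [set: J] ell
    (finset.subsetT [set c i | i : 'I_k]%SET).
  rewrite cardsT (ltnW hell) andbT (leq_trans (leq_imset_card _ _))//.
  by rewrite card_ord.
have S0 : (0 < #|S|)%N by rewrite eS.
have : CDC R (cardinality_family J ell) (barycenter R J S).
  by exists S; [rewrite /= finset.inE eS | apply/barycenter_face].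
rewrite hL => /(_ j I)[i _ /(barycenter_face _ _ _ _ S0)/fintype.subsetP sSL].
have /negP := hc i; apply; apply: sSL; apply: (fintype.subsetP cS).
exact: imset_f.
Qed.

Lemma cardinality_IB_upper (R : realType) (J : finType) (ell k : nat) :
  (ell < #|J|)%N -> (ell < k)%N ->
  IB_representable R (cardinality_family J ell) k.
Proof.
move=> hell ltk.
have /card_gt0P[v0 _] := leq_ltn_trans (leq0n ell) hell.
pose i0 := Ordinal (leq_ltn_trans (leq0n ell) ltk).
(* [L C i] drops the [i]-th element of [C]; sets [C] of size other than
   [ell + 1] impose no constraint beyond membership in the simplex. *)
pose L (C : {set J}) (i : 'I_k) : {set J} :=
  if #|C| == ell.+1 then [set~ nth (nth v0 (enum C) 0) (enum C) i]%SET
  else [set: J]%SET.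
exists #|{set J}|, (fun j i => L (enum_val j) i).
apply/seteqP; split=> x.
  move=> /(CDC_cardinalityP _ _ _ _ (ltnW hell))[sx lex] j _.
  set C := enum_val j.
  have [cC|cC] := eqVneq #|C| ell.+1; last first.
    by exists i0 => //; rewrite /L (negbTE cC); split=> // v; rewrite finset.inE.
  (* The support is too small to contain [C]; the position of a vanishing coordinate in [enum C]
     selects the disjunct. *)
  have /subsetPn[v vC] : ~~ (C \subset [set v | x v != 0]%SET).
    by apply/negP => /subset_leq_card; rewrite cC leqNgt ltnS lex.
  rewrite finset.inE negbK => /eqP xv.
  have iv : (index v (enum C) < #|C|)%N by rewrite cardE index_mem mem_enum.
  have ik : (index v (enum C) < k)%N by apply: leq_trans iv _; rewrite cC.
  exists (Ordinal ik) => //; rewrite /L cC eqxx /=; split=> // w.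
  by rewrite nth_index ?mem_enum// !finset.inE negbK => /eqP ->; rewrite xv.
move=> hx; apply/(CDC_cardinalityP _ _ _ _ (ltnW hell)).
(* Any index would do: every face lies in the simplex. *)
have sx : simplex R J x by have [i _ []] := hx (enum_rank finset.set0) I.
split=> //; rewrite leqNgt; apply/negP => ltx.
(* With [C] inside the support, the disjunction of [C] makes some coordinate in the support
   nonpositive. *)
have [|C [_ Cx cC]] := @subset_between_card J _ [set v | x v != 0]%SET ell.+1
    (finset.sub0set _); first by rewrite cards0.
have [i _ [_]] := hx (enum_rank C) I; rewrite enum_rankK /L cC eqxx.
set c := nth _ _ _ => /(_ c); rewrite !finset.inE eqxx => /(_ isT) xc.
have cinC : c \in C.
  (* If [k > ell.+1], the index [i] may run past [enum C]; the default of [nth] is then the first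
     element of [C]. *)
  rewrite -mem_enum /c; have [lti|gei] := ltnP i (size (enum C)).
    exact: mem_nth.
  by rewrite nth_default// mem_nth// -cardE cC.
have := fintype.subsetP Cx _ cinC; rewrite finset.inE => /negP; apply.
by rewrite eq_le xc sx.1.
Qed.

(** The bound [hell] is strict because for [ell = #|J|] the CDC is the whole simplex, for which
    [k = 1] suffices. *)
Theorem corollary1 (R : realType) (J : finType) (ell k : nat)
    (hirr : irredundant (cardinality_family J ell))
    (hcov : covers (cardinality_family J ell))
    (hell : (ell < #|J|)%N) :
  IB_representable R (cardinality_family J ell) k <-> (ell < k)%N.
Proof.
split; last exact: cardinality_IB_upper.
apply: cardinality_IB_lower => //.
exact: covers_cardinality_gt0 (leq_ltn_trans (leq0n ell) hell) hcov.
Qed.
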